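(* Consider the stochastic shortest path problem described in the context, and assume that the disturbance set $W$ is finite. Then: (a) $\hat J$ is the unique solution $J$, within the set $\widehat{\mathcal W}$, of the Bellman equation $$J(x)=\inf_{u\in U(x)}E\big\{g(x,u,w)+J(f(x,u,w))\big\},\qquad x\in X.$$ (b) If $\{J_k\}$ is the sequence generated by the value iteration algorithm $$J_{k+1}(x)=\inf_{u\in U(x)}E\big\{g(x,u,w)+J_k(f(x,u,w))\big\},\qquad x\in X,\ k=0,1,\ldots,$$ starting with some $J_0\in\widehat{\mathcal W}$, then $J_k\to\hat J$ pointwise. (c) If $\mu$ is a stationary policy that is proper at all $x\in\widehat X$, and for all $x\in X$ we have $$\mu(x)\in\arg\min_{u\in U(x)}E\big\{g(x,u,w)+\hat J(f(x,u,w))\big\},\qquad ( * )$$ then $\mu$ is optimal over the set of proper policies, i.e., $J_\mu=\hat J$. Conversely, if $\mu$ is a stationary policy that is proper at all $x\in\widehat X$ and is optimal within the set of proper policies, i.e., $J_\mu=\hat J$, then $\mu$ satisfies $( * )$ for all $x\in X$.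
   Context: Problem. $X$ (states) and $U$ (controls) are arbitrary sets; $W$ is the set of disturbances. For each $x\in X$ there is a nonempty constraint set $U(x)\subset U$. The system is $x_{k+1}=f(x_k,u_k,w_k)$, $k=0,1,\ldots$, with $f:X\times U\times W\to X$, where $w_k$ has given probability distribution $P(w_k\mid x_k,u_k)$ on $W$. The cost per stage is a function $g$ on $X\times U\times W$ with nonnegative, finite expected value: $0\le E\{g(x,u,w)\}<\infty$ for all $x\in X$, $u\in U(x)$, where $E$ is with respect to $P(w\mid x,u)$. There is a special destination state $t\in X$ that is cost-free and absorbing: $f(t,u,w)=t$ and $g(t,u,w)=0$ for all $u\in U(t)$, $w\in W$. Policies. A policy is a sequence $\pi=\{\mu_0,\mu_1,\ldots\}$ of functions $\mu_k:X\to U$ with $\mu_k(x)\in U(x)$ for all $x$; $\Pi$ is the set of all policies. A policy $\{\mu,\mu,\ldots\}$ is called stationary and denoted by $\mu$. $E^\pi_{x_0}$ is expectation with respect to the probability measure on trajectories induced by initial state $x_0$ and policy $\pi$. The cost function of $\pi$ is $J_\pi(x_0)=\sum_{k=0}^\infty E^\pi_{x_0}\{g(x_k,\mu_k(x_k),w_k)\}\in[0,\infty]$, and $J_\mu$ denotes the cost function of a stationary policy $\mu$. Proper policies. Let $r_k(\pi,x)$ be the probability that $x_k\ne t$ when using $\pi$ and starting from $x_0=x$. A policy $\pi$ is proper at $x$ if $J_\pi(x)<\infty$ and $\sum_{k=0}^\infty r_k(\pi,x)<\infty$. $\widehat\Pi_x$ is the set of policies that are proper at $x$; $\mathcal C=\{(\pi,x)\mid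 \pi\in\widehat\Pi_x\}$; $\hat J(x)=\inf_{\pi\in\widehat\Pi_x}J_\pi(x)$ (with $\inf\emptyset=\infty$); $\widehat X=\{x\in X\mid\hat J(x)<\infty\}$. Function sets. $\mathcal J$ is the set of functions $J:X\to[0,\infty]$ with $J(t)=0$, and $$\widehat{\mathcal W}=\Big\{J\in\mathcal J\ \Big|\ \hat J\le J,\ E^\pi_{x_0}\{J(x_k)\}\to0\text{ as }k\to\infty\text{ for all }(\pi,x_0)\in\mathcal C\Big\},$$ where $\{x_k\}$ is the state sequence generated from $x_0$ using $\pi$. All inequalities and limits between functions are pointwise. $\arg\min$ denotes the set of $u\in U(x)$ attaining the infimum (which may equal $\infty$).
   Formalization: In (c), J_μ = Ĵ is read as equality on X̂ only; on all of X the forward claim fails (X={t,1}, one control, f(x,·)=x, g=0: ( * ) holds at 1 as ∞=∞, yet J_μ(1)=0 and Ĵ(1)=∞). *)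

(* Defs.v *)
From HB Require Import structures.
From mathcomp Require Import all_boot all_order all_algebra.
From mathcomp Require Import all_classical all_reals.
From mathcomp Require Import ereal topology normedtype sequences.

Set Implicit Arguments.
Unset Strict Implicit.
Unset Printing Implicit Defensive.

Import Order.TTheory GRing.Theory Num.Theory.
Import numFieldNormedType.Exports.

Local Open Scope classical_set_scope.
Local Open Scope ring_scope.
Local Open Scope ereal_scope.

(* [0 * +oo = 0] in [\bar R], so disturbances of probability zero do not
   contribute, whatever the value of [h] there. *)
Definition expect (R : realType) (W : finType) (p : W -> R) (h : W -> \bar R) :
    \bar R :=
  \sum_(w : W) (p w)%:E * h w.

(* Stochastic shortest path problem. [prob x u w] is P(w | x, u). Nothing is
   assumed about [prob], [cost] and [dyn] at controls outside [ctrl x]. The cost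
   itself may take negative values; only its expectation is nonnegative. *)
Record ssp (R : realType) (X U : Type) (W : finType) := SSP {
  ctrl : X -> set U;
  dyn : X -> U -> W -> X;
  prob : X -> U -> W -> R;
  cost : X -> U -> W -> R;
  dest : X;
  ctrl_nonempty : forall x, ctrl x !=set0;
  prob_ge0 : forall x u w, ctrl x u -> (0 <= prob x u w)%R;
  prob_sum1 : forall x u, ctrl x u -> (\sum_(w : W) prob x u w)%R = 1%R;
  cost_expect : forall x u, ctrl x u ->
    0 <= expect (prob x u) (fun w => (cost x u w)%:E) < +oo;
  dest_absorbing : forall u w, ctrl dest u -> dyn dest u w = dest;
  dest_cost_free : forall u w, ctrl dest u -> cost dest u w = 0%R
}.

Section SSP.
Variables (R : realType) (X U : Type) (W : finType) (S : ssp R X U W).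

Implicit Types (pi : nat -> X -> U) (mu : X -> U) (J : X -> \bar R).

Definition policy pi : Prop := forall k x, ctrl S x (pi k x).

(* A stationary policy [mu] is identified with the constant sequence. *)
Definition stationary mu : nat -> X -> U := fun=> mu.

(* State reached from [x] under [pi] after the disturbances
   [s = [:: w_0; ...; w_(k-1)]]. *)
Fixpoint state pi (x : X) (s : seq W) : X :=
  if s is w :: s' then state (fun k => pi k.+1) (dyn S x (pi 0%N x) w) s'
  else x.

(* Probability that the first disturbances are [s], that is the product of the
   conditional probabilities P(w_i | x_i, mu_i(x_i)). *)
Fixpoint path_prob pi (x : X) (s : seq W) : R :=
  if s is w :: s' then
    (prob S x (pi 0%N x) w *
     path_prob (fun k => pi k.+1) (dyn S x (pi 0%N x) w) s')%R
  else 1%R.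

(* Expectation of J(x_k). The measure on trajectories enters only through its
   marginals on the first disturbances, which have finite support since [W] is
   finite. *)
Definition expect_state pi (x : X) (k : nat) J : \bar R :=
  \sum_(s : k.-tuple W) (path_prob pi x s)%:E * J (state pi x s).

(* Expectation of g(x_k, mu_k(x_k), w_k); [rcons s w] is (w_0, ..., w_k). *)
Definition expect_cost pi (x : X) (k : nat) : \bar R :=
  \sum_(s : k.-tuple W) \sum_(w : W)
    (path_prob pi x (rcons s w))%:E *
    (cost S (state pi x s) (pi k (state pi x s)) w)%:E.

Definition policy_cost pi (x : X) : \bar R :=
  \sum_(0 <= k <oo) expect_cost pi x k.

(* Probability that x_k differs from the destination. *)
Definition nonterm_prob pi (x : X) (k : nat) : R :=
  (\sum_(s : k.-tuple W | `[< state pi x s <> dest S >]) path_prob pi x s)%R.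

Definition proper_at (x : X) : set (nat -> X -> U) :=
  [set pi | [/\ policy pi, policy_cost pi x < +oo &
                \sum_(0 <= k <oo) (nonterm_prob pi x k)%:E < +oo]].

Definition Jhat (x : X) : \bar R :=
  ereal_inf [set policy_cost pi x | pi in proper_at x].

Definition Xhat : set X := [set x | Jhat x < +oo].

Definition cost_functions : set (X -> \bar R) :=
  [set J | (forall x, 0 <= J x) /\ J (dest S) = 0].

Definition What : set (X -> \bar R) :=
  [set J | [/\ cost_functions J,
               (forall x, Jhat x <= J x) &
               (forall pi x, proper_at x pi ->
                  expect_state pi x k J @[k --> \oo] --> 0)]].

Definition Qvalue J (x : X) (u : U) : \bar R :=
  expect (prob S x u) (fun w => (cost S x u w)%:E + J (dyn S x u w)).

Definition bellman J (x : X) : \bar R :=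
  ereal_inf [set Qvalue J x u | u in ctrl S x].

Definition argmin_bellman J (x : X) : set U :=
  [set u | ctrl S x u /\ Qvalue J x u = bellman J x].

(* Optimality within the proper policies is the equality of the cost of [mu]
   and [Jhat] on [Xhat]. Outside [Xhat] there is no proper policy to compare
   with, and [Jhat] is [+oo] there by convention while the cost of [mu] may be
   finite: with one control, zero cost and a second absorbing state x <> dest,
   [Jhat x = +oo] although the cost of the only policy is 0. *)
Definition optimal_among_proper mu : Prop :=
  forall x, Xhat x -> policy_cost (stationary mu) x = Jhat x.

End SSP.

(* Main.v *)
Require Import Defs.
From HB Require Import structures.
From mathcomp Require Import all_boot all_order all_algebra.
From mathcomp Require Import all_classical all_reals.
From mathcomp Require Import ereal topology normedtype sequences.
From mathcomp Require Import ring.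

(** Everything rests on one comparison principle and one perturbation.

    Comparison ([total_le_supersolution], [near_optimal_policy]). Let [h] be a
    nonnegative stage cost, and let [J >= 0] satisfy [bellman_op h J <= J].
    Choosing at stage [k] a control that attains the infimum up to
    [eps / 2 ^ k.+1] yields a policy of total cost at most [J + eps] at every
    state. The minimal total cost [optimum h] is itself such a [J], because the
    tail of a policy after one step is again a policy ([totalS]).
    By monotonicity [bellman_op h (optimum h)] is a supersolution too.

    Perturbation. Comparison alone says nothing about properness, so a cost
    [d > 0] is charged for every stage spent away from the destination: a policy
    has finite perturbed cost exactly when it is proper. Hence [Jhat] lies below
    every supersolution of the perturbed equation
    ([Jhat_le_supersolution]), in particular below
    [bellman_op h (optimum h)] for the perturbed [h]. Since there are finitely
    many disturbances, a single small [d] makes this at most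
    [bellman_op stage_cost Jhat] up to an arbitrary error
    ([Jhat_le_Qvalue]). This detour is what makes Markov policies suffice:
    near-optimal policies chosen separately for each successor state cannot be
    pasted into one Markov policy, since their trajectories may meet again.
    The opposite inequality follows from splitting off the first stage of a
    proper policy.

    Along a proper policy the expected value of [Jhat] at time [k] is at most the
    cost incurred from time [k] on ([expect_state_Jhat_le_tail]), a tail of a
    convergent series; so [Jhat] belongs to [What]. For value iteration from
    [J0] in [What], the [k]-th iterate is at least [Jhat] by monotonicity and at
    most the [k]-stage cost of any policy with terminal cost [J0]; for a proper
    policy the latter tends to the cost of the policy ([iterate_cvg]). Uniqueness
    is the case of a constant sequence of iterates. The two halves of (c) are the
    comparison principle with zero errors, and the one-step decomposition of the
    cost of [mu]. *)

Set Implicit Arguments.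
Unset Strict Implicit.
Unset Printing Implicit Defensive.

Import Order.TTheory GRing.Theory Num.Theory.
Import numFieldNormedType.Exports.

Local Open Scope classical_set_scope.
Local Open Scope ring_scope.
Local Open Scope ereal_scope.

(** * Extended real sums and limits *)

Lemma le_limn_esup (R : realType) (u v : (\bar R)^nat) :
  (forall n, u n <= v n) -> limn_esup u <= limn_esup v.
Proof.
move=> uv; apply: le_ereal_inf_tmp => _ [A Aoo <-].
apply: ge_ereal_inf; exists (ereal_sup [set u n | n in A]); first by exists A.
apply: ge_ereal_sup => _ [n An <-].
by apply: le_trans (uv n) _; apply: ereal_sup_ubound; exists n.
Qed.

Section Expect.
Variables (R : realType) (W : finType) (p : W -> R).
Hypothesis p_ge0 : forall w, (0 <= p w)%R.
Implicit Types h : W -> \bar R.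

Lemma expect_ge0 h : (forall w, 0 <= h w) -> 0 <= expect p h.
Proof.
by move=> h0; apply: sume_ge0 => w _; rewrite mule_ge0 ?lee_fin.
Qed.

Lemma le_expect h1 h2 :
  (forall w, (0 < p w)%R -> h1 w <= h2 w) -> expect p h1 <= expect p h2.
Proof.
move=> h12; apply: lee_sum => w _.
have := p_ge0 w; rewrite le_eqVlt => /predU1P[<-|pw]; first by rewrite !mul0e.
by apply: lee_wpmul2l; [rewrite lee_fin ltW | exact: h12].
Qed.

(** The stage cost may be negative but is real, whereas cost-to-go functions are
    nonnegative but may be infinite; either condition on [h1] keeps the sum away
    from [+oo - oo]. *)
Lemma expectD h1 h2 : (forall w, (h1 w) \is a fin_num) \/ (forall w, 0 <= h1 w) ->
  (forall w, 0 <= h2 w) ->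
  expect p (fun w => h1 w + h2 w) = expect p h1 + expect p h2.
Proof.
move=> h1E h20; rewrite /expect -big_split; apply: eq_bigr => w _ /=.
case: h1E => [h1fin|h10]; last by rewrite ge0_muleDr.
by rewrite muleDr // fin_num_adde_defr.
Qed.

Lemma expect_cst (c : R) : (\sum_w p w)%R = 1%R -> expect p (fun=> c%:E) = c%:E.
Proof.
move=> p1; rewrite /expect -[RHS]mul1e -p1 -sumEFin ge0_sume_distrl // => w _.
by rewrite lee_fin.
Qed.

(** Only disturbances of positive probability are constrained: [0 * +oo = 0]. *)
Lemma expect_lty h w : expect p h < +oo -> (forall w, 0 <= h w) ->
  (0 < p w)%R -> h w < +oo.
Proof.
move=> hoo h0 pw; rewrite ltey; apply/eqP => hw; move: hoo.
rewrite /expect (bigD1 w) //= hw gt0_muley ?lte_fin // addye ?ltxx //.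
rewrite gt_eqF // (lt_le_trans ltNy0) //.
by apply: sume_ge0 => v _; rewrite mule_ge0 ?lee_fin.
Qed.

Lemma expect_nneseries (h : W -> nat -> \bar R) : (forall w k, 0 <= h w k) ->
  \sum_(0 <= k <oo) expect p (h^~ k) = expect p (fun w => \sum_(0 <= k <oo) h w k).
Proof.
move=> h0; rewrite /expect nneseries_sum => [|w k _]; last first.
  by rewrite mule_ge0 ?lee_fin.
by apply: eq_bigr => w _; rewrite nneseriesZl.
Qed.

End Expect.

Lemma big_tupleS (R : realType) (W : finType) k (F : W -> seq W -> \bar R) :
  \sum_(s : k.+1.-tuple W) F (thead s) (behead s) =
  \sum_(w : W) \sum_(s : k.-tuple W) F w s.
Proof.
rewrite pair_big /= (reindex (fun u : W * k.-tuple W => cons_tuple u.1 u.2)) /=.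
  by apply: eq_bigr => -[w s] _ /=; rewrite theadE.
exists (fun s : k.+1.-tuple W => (thead s, behead_tuple s)) => [[w s]|s] _ /=.
  by rewrite theadE; congr pair; apply: val_inj.
by rewrite [s]tuple_eta; apply: val_inj => /=; rewrite theadE.
Qed.

(** * One-step recursions along a policy *)

Section Dynamics.
Variables (R : realType) (X U : Type) (W : finType) (S : ssp R X U W).
Implicit Types (pi : nat -> X -> U) (J : X -> \bar R) (h : X -> U -> \bar R).

Definition mean x u J : \bar R := expect (prob S x u) (fun w => J (dyn S x u w)).

Definition stage_cost x u : \bar R :=
  expect (prob S x u) (fun w => (cost S x u w)%:E).

(** As a stage cost, [away] charges one unit per stage before termination, so
    that the second summability condition of properness becomes the finiteness
    of a total cost. The control argument gives it the type of a stage cost. *)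
Definition away x (u : U) : \bar R := (`[< x <> dest S >]%:R)%:E.

Definition shift pi : nat -> X -> U := fun k => pi k.+1.

Lemma policy_shift pi : policy S pi -> policy S (shift pi).
Proof. by move=> pol k x; exact: pol. Qed.

Definition nonneg h := forall x u, ctrl S x u -> 0 <= h x u.

Lemma stage_cost_ge0 : nonneg stage_cost.
Proof. by move=> x u ux; have /andP[] := cost_expect ux. Qed.

Lemma away_ge0 : nonneg away.
Proof. by move=> x u _; rewrite lee_fin ler0n. Qed.

Hint Resolve stage_cost_ge0 away_ge0 : core.

Lemma mean_ge0 x u J : ctrl S x u -> (forall y, 0 <= J y) -> 0 <= mean x u J.
Proof. by move=> ux J0; apply: expect_ge0 => // w; exact: prob_ge0. Qed.

Lemma le_mean x u J1 J2 : ctrl S x u ->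
  (forall w, (0 < prob S x u w)%R -> J1 (dyn S x u w) <= J2 (dyn S x u w)) ->
  mean x u J1 <= mean x u J2.
Proof. by move=> ux J12; apply: le_expect => // w; exact: prob_ge0. Qed.

Lemma meanD x u J1 J2 : ctrl S x u ->
  (forall y, 0 <= J1 y) -> (forall y, 0 <= J2 y) ->
  mean x u (fun y => J1 y + J2 y) = mean x u J1 + mean x u J2.
Proof. by move=> ux J10 J20; apply: expectD; auto. Qed.

Lemma mean_cst x u (c : R) : ctrl S x u -> mean x u (fun=> c%:E) = c%:E.
Proof.
by move=> ux; apply: expect_cst => [w|]; [exact: prob_ge0|exact: prob_sum1].
Qed.

Lemma mean_addr x u J (c : R) : ctrl S x u -> (forall y, 0 <= J y) ->
  mean x u (fun y => J y + c%:E) = mean x u J + c%:E.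
Proof.
move=> ux J0; rewrite -[in RHS](mean_cst c ux) addeC /mean -expectD //; last by left.
by congr expect; apply/funext => w; rewrite addeC.
Qed.

Lemma QvalueE J x u : ctrl S x u -> (forall y, 0 <= J y) ->
  Qvalue S J x u = stage_cost x u + mean x u J.
Proof. by move=> ux J0; apply: expectD => //; left. Qed.

Lemma path_prob_ge0 pi x s : policy S pi -> (0 <= path_prob S pi x s)%R.
Proof.
elim: s pi x => //= w s IH pi x pol.
by rewrite mulr_ge0 ?(prob_ge0 _ (pol 0%N x)) ?IH //; exact: policy_shift.
Qed.

Lemma path_prob_rcons pi x s w : path_prob S pi x (rcons s w) =
  (path_prob S pi x s *
   prob S (state S pi x s) (pi (size s) (state S pi x s)) w)%R.
Proof.
elim: s pi x => [|v s IH] pi x /=; first by rewrite mulr1 mul1r.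
by rewrite IH mulrA.
Qed.

Lemma expect_state_ge0 pi x k J : policy S pi -> (forall y, 0 <= J y) ->
  0 <= expect_state S pi x k J.
Proof.
move=> pol J0; apply: sume_ge0 => s _.
by rewrite mule_ge0 // lee_fin path_prob_ge0.
Qed.

Lemma expect_state0 pi x J : expect_state S pi x 0 J = J x.
Proof.
rewrite /expect_state (big_pred1 [tuple]) => [|s]; first by rewrite /= mul1e.
by apply/esym/eqP; exact: tuple0.
Qed.

Lemma expect_stateS pi x k J : policy S pi -> (forall y, 0 <= J y) ->
  expect_state S pi x k.+1 J =
  mean x (pi 0%N x) (fun y => expect_state S (shift pi) y k J).
Proof.
move=> pol J0.
pose F w s := (path_prob S pi x (w :: s))%:E * J (state S pi x (w :: s)).
transitivity (\sum_(s : k.+1.-tuple W) F (thead s) (behead s)).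
  by apply: eq_bigr => s _; rewrite /F; case/tupleP: s => w s; rewrite theadE.
rewrite big_tupleS; apply: eq_bigr => w _.
rewrite ge0_sume_distrr => [|s _]; last first.
  by rewrite mule_ge0 // lee_fin path_prob_ge0 //; exact: policy_shift.
by apply: eq_bigr => s _; rewrite /F /= EFinM muleA.
Qed.

Lemma expect_stateD pi x k J1 J2 : policy S pi ->
  (forall y, 0 <= J1 y) -> (forall y, 0 <= J2 y) ->
  expect_state S pi x k (fun y => J1 y + J2 y) =
  expect_state S pi x k J1 + expect_state S pi x k J2.
Proof.
move=> pol J10 J20; rewrite /expect_state -big_split; apply: eq_bigr => s _ /=.
by rewrite ge0_muleDr.
Qed.

Lemma expect_stateZ pi x k (c : R) J : (forall y, 0 <= J y) -> policy S pi ->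
  expect_state S pi x k (fun y => c%:E * J y) = c%:E * expect_state S pi x k J.
Proof.
move=> J0 pol; rewrite /expect_state ge0_sume_distrr => [|s _]; last first.
  by rewrite mule_ge0 // lee_fin path_prob_ge0.
by apply: eq_bigr => s _; rewrite muleCA.
Qed.

(** Averaging over the last disturbance first turns the cost at time [k] into a
    function of the state at time [k], so that a single notion of total cost
    covers both conditions of properness. *)
Lemma expect_costE pi x k : policy S pi ->
  expect_cost S pi x k =
  expect_state S pi x k (fun y => stage_cost y (pi k y)).
Proof.
move=> pol; apply: eq_bigr => s _; rewrite /stage_cost /expect.
rewrite fin_num_sume_distrr //.
by apply: eq_bigr => w _; rewrite path_prob_rcons size_tuple EFinM muleA.
Qed.

Lemma nonterm_probE pi x k : 
  (nonterm_prob S pi x k)%:E =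
  expect_state S pi x k (fun y => away y (pi k y)).
Proof.
rewrite /nonterm_prob -sumEFin big_mkcond /=; apply: eq_bigr => s _.
by rewrite /away; case: ifP => _; rewrite (mule1, mule0).
Qed.

Definition tail h k pi x : \bar R :=
  \sum_(k <= i <oo) expect_state S pi x i (fun y => h y (pi i y)).

Definition total h : (nat -> X -> U) -> X -> \bar R := tail h 0.

Lemma policy_costE pi x : policy S pi -> policy_cost S pi x = total stage_cost pi x.
Proof.
by move=> pol; apply: eq_eseriesr => k _; rewrite expect_costE.
Qed.

Lemma properE pi x : proper_at S x pi <->
  [/\ policy S pi, total stage_cost pi x < +oo & total away pi x < +oo].
Proof.
have E : \sum_(0 <= k <oo) (nonterm_prob S pi x k)%:E = total away pi x.
  by apply: eq_eseriesr => k _; rewrite nonterm_probE.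
rewrite /proper_at /= E.
by split=> -[pol]; [|rewrite -policy_costE //]; rewrite ?policy_costE.
Qed.

Section Total.
Variable h : X -> U -> \bar R.
Hypothesis h0 : nonneg h.

Lemma expect_stage_ge0 pi x k : policy S pi ->
  0 <= expect_state S pi x k (fun y => h y (pi k y)).
Proof. by move=> pol; apply: expect_state_ge0 => // y; exact: h0. Qed.

Lemma total_ge0 pi x : policy S pi -> 0 <= total h pi x.
Proof. by move=> pol; apply: nneseries_ge0 => k _ _; exact: expect_stage_ge0. Qed.

Lemma tailS k pi x : policy S pi ->
  tail h k.+1 pi x = mean x (pi 0%N x) (tail h k (shift pi)).
Proof.
move=> pol; have pol' := policy_shift pol.
rewrite /tail -nneseries_addn => [|i]; last exact: expect_stage_ge0.
transitivity (mean x (pi 0%N x) (fun y => \sum_(i <oo)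
    expect_state S (shift pi) y (i + k) (fun z => h z (shift pi (i + k) z)))).
  rewrite /mean -expect_nneseries => [|w|w i].
  - apply: eq_eseriesr => i _; rewrite addnS expect_stateS // => y; exact: h0.
  - exact: prob_ge0.
  - exact: expect_stage_ge0.
congr mean; apply/funext => y; rewrite -[RHS]nneseries_addn // => i.
exact: expect_stage_ge0.
Qed.

Lemma totalS pi x : policy S pi ->
  total h pi x = h x (pi 0%N x) + mean x (pi 0%N x) (total h (shift pi)).
Proof.
move=> pol; rewrite -tailS // /total /tail nneseries_recl => [|k _|//].
  by rewrite expect_state0.
exact: expect_stage_ge0.
Qed.

(** Cost of [n] stages followed by the terminal cost [J]. *)
Definition horizon J n pi x : \bar R :=
  \sum_(0 <= k < n) expect_state S pi x k (fun y => h y (pi k y)) +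
  expect_state S pi x n J.

Lemma horizon0 J pi x : horizon J 0 pi x = J x.
Proof. by rewrite /horizon big_nil add0e expect_state0. Qed.

Lemma horizon_ge0 J n pi x : policy S pi -> (forall y, 0 <= J y) ->
  0 <= horizon J n pi x.
Proof.
move=> pol J0; rewrite adde_ge0 ?expect_state_ge0 // sume_ge0 // => k _.
exact: expect_stage_ge0.
Qed.

Lemma horizonS J n pi x : policy S pi -> (forall y, 0 <= J y) ->
  horizon J n.+1 pi x =
  h x (pi 0%N x) + mean x (pi 0%N x) (horizon J n (shift pi)).
Proof.
move=> pol J0; have pol' := policy_shift pol.
have hk k y : 0 <= h y (pi k y) by exact: h0.
rewrite /horizon big_nat_recl // expect_state0 -addeA; congr (_ + _).
rewrite meanD => [|//|y|y]; last 2 first.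
- by rewrite sume_ge0 // => k _; exact: expect_stage_ge0.
- exact: expect_state_ge0.
rewrite expect_stateS //; congr (_ + _).
under eq_bigr do rewrite expect_stateS //.
rewrite /mean /expect exchange_big; apply: eq_bigr => w _ /=.
by rewrite ge0_sume_distrr // => k _; exact: expect_stage_ge0.
Qed.

Lemma horizon_cvg J pi x : policy S pi -> (forall y, 0 <= J y) ->
  expect_state S pi x k J @[k --> \oo] --> 0 ->
  horizon J n pi x @[n --> \oo] --> total h pi x.
Proof.
move=> pol J0 EJ; rewrite -[total h pi x]adde0; apply: cvgeD => //.
  by rewrite ge0_adde_def // inE ?total_ge0.
by apply: is_cvg_nneseries => k _ _; exact: expect_stage_ge0.
Qed.

(** * Supersolutions of the Bellman equation *)

(** Induction on the horizon: if [J] pays for each stage up to the error [e k],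
    the cost of [n] stages with terminal cost [J] is at most [J] plus the first
    [n] errors. The nonnegative terminal cost is then dropped. *)
Lemma total_le_supersolution J (e : nat -> R) (c : R) pi x :
  policy S pi -> (forall y, 0 <= J y) ->
  (forall k y, h y (pi k y) + mean y (pi k y) J <= J y + (e k)%:E) ->
  (forall n, (\sum_(0 <= k < n) e k <= c)%R) ->
  total h pi x <= J x + c%:E.
Proof.
move=> pol J0 piJ ec.
have horizon_le n : horizon J n pi x <= J x + (\sum_(0 <= k < n) e k)%:E.
  elim: n pi x e pol piJ {ec} => [|n IH] pi x e pol piJ.
    by rewrite horizon0 big_nil adde0.
  rewrite horizonS // big_nat_recl // EFinD addeA.
  apply: le_trans (leeD2r _ (piJ 0%N x)); rewrite -addeA leeD2l //.
  rewrite -mean_addr //; apply: le_mean => // w _.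
  apply: (IH _ _ (fun k => e k.+1)) => [|k y]; first exact: policy_shift.
  exact: (piJ k.+1).
apply: lime_le.
  by apply: is_cvg_nneseries => k _ _; exact: expect_stage_ge0.
apply: nearW => n; apply: (@le_trans _ _ (J x + (\sum_(0 <= k < n) e k)%:E)).
  apply: le_trans (horizon_le n); rewrite /horizon leeDl //.
  exact: expect_state_ge0.
by rewrite leeD2l // lee_fin.
Qed.

(** For [J >= 0] and [h] the expected stage cost this is [bellman]; a general [h]
    makes room for the perturbed cost. *)
Definition bellman_op J x : \bar R :=
  ereal_inf [set h x u + mean x u J | u in ctrl S x].

Lemma bellman_op_lb J x u : ctrl S x u -> bellman_op J x <= h x u + mean x u J.
Proof. by move=> ux; apply: ereal_inf_lbound; exists u. Qed.

Lemma bellman_op_ge0 J x : (forall y, 0 <= J y) -> 0 <= bellman_op J x.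
Proof.
move=> J0; apply: le_ereal_inf_tmp => _ [u ux <-].
by rewrite adde_ge0 ?h0 ?mean_ge0.
Qed.

Lemma le_bellman_op J1 J2 x : (forall y, J1 y <= J2 y) ->
  bellman_op J1 x <= bellman_op J2 x.
Proof.
move=> J12; apply: le_ereal_inf_tmp => _ [u ux <-].
by apply: le_trans (bellman_op_lb _ ux) _; rewrite leeD2l // le_mean.
Qed.

(** The control selected at a state depends on the stage only through the
    tolerance, so the selection is a Markov policy that is near-optimal from all
    initial states simultaneously. *)
Lemma near_optimal_policy J (eps : R) : (0 < eps)%R ->
  (forall x, 0 <= J x) -> (forall x, bellman_op J x <= J x) ->
  exists2 pi, policy S pi & forall x, total h pi x <= J x + eps%:E.
Proof.
move=> eps0 J0 TJ; pose e k : R := (eps / (2 ^ k.+1)%:R)%R.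
have e0 k : (0 < e k)%R by rewrite divr_gt0 // ltr0n expn_gt0.
have /choice[f fP] (ky : nat * X) : exists u, ctrl S ky.2 u /\
    h ky.2 u + mean ky.2 u J <= J ky.2 + (e ky.1)%:E.
  (* Where [J] is infinite any control will do. *)
  case: ky => k y /=; have [Jfin|] := boolP (J y \is a fin_num).
    have : bellman_op J y < J y + (e k)%:E.
      by apply: le_lt_trans (TJ y) _; rewrite lteDl // lte_fin.
    by case/ereal_inf_lt => _ [u uy <-] /ltW uJ; exists u.
  rewrite ge0_fin_numE // -leNgt leye_eq => /eqP ->.
  by have [u uy] := ctrl_nonempty S y; exists u; rewrite addye // leey.
exists (fun k y => f (k, y)) => [k y|x]; first by case: (fP (k, y)).
apply: (@total_le_supersolution J e) => // [k y|k y|n].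
- by case: (fP (k, y)).
- by case: (fP (k, y)).
rewrite -lee_fin -sumEFin; apply: le_trans (epsilon_trick0 xpredT (ltW eps0)).
by apply: nneseries_lim_ge => k _ _; rewrite lee_fin ltW.
Qed.

Definition optimum x : \bar R := ereal_inf [set total h pi x | pi in policy S].

Lemma optimum_ge0 x : 0 <= optimum x.
Proof. by apply: le_ereal_inf_tmp => _ [pi pol <-]; exact: total_ge0. Qed.

Lemma optimum_lb pi x : policy S pi -> optimum x <= total h pi x.
Proof. by move=> pol; apply: ereal_inf_lbound; exists pi. Qed.

(** No selection is involved here: the shift of a policy starting from each
    successor state is a competitor there. *)
Lemma optimum_supersolution x : bellman_op optimum x <= optimum x.
Proof.
apply: le_ereal_inf_tmp => _ [pi pol <-]; rewrite totalS //.
apply: le_trans (bellman_op_lb _ (pol 0%N x)) _; rewrite leeD2l // le_mean //.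
by move=> w _; apply: optimum_lb; exact: policy_shift.
Qed.

Lemma total_shift_lty pi x w : policy S pi -> total h pi x < +oo ->
  (0 < prob S x (pi 0%N x) w)%R ->
  total h (shift pi) (dyn S x (pi 0%N x) w) < +oo.
Proof.
move=> pol; have pol' := policy_shift pol; rewrite totalS // => too pw.
have : mean x (pi 0%N x) (total h (shift pi)) < +oo.
  by apply: le_lt_trans too; rewrite leeDr // h0.
move/expect_lty; apply => // [v|v]; first exact: prob_ge0.
exact: total_ge0.
Qed.

End Total.

Lemma bellmanE J x : (forall y, 0 <= J y) ->
  bellman S J x = bellman_op stage_cost J x.
Proof.
move=> J0; rewrite /bellman /bellman_op; congr ereal_inf.
by apply/seteqP; split=> _ [u ux <-]; exists u; rewrite // QvalueE.
Qed.

(** * The Bellman equation for proper policies *)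

Definition perturbed (d : R) x u : \bar R := stage_cost x u + d%:E * away x u.

Lemma perturbed_ge0 (d : R) : (0 <= d)%R -> nonneg (perturbed d).
Proof.
by move=> d0 x u ux; rewrite adde_ge0 ?stage_cost_ge0 // mule_ge0 ?away_ge0.
Qed.

Lemma perturbed_le (d : R) x u : (0 <= d)%R ->
  perturbed d x u <= stage_cost x u + d%:E.
Proof.
move=> d0; rewrite leeD2l // /away -EFinM lee_fin.
by case: asbool; rewrite (mulr1, mulr0).
Qed.

Lemma total_perturbed (d : R) pi x : (0 <= d)%R -> policy S pi ->
  total (perturbed d) pi x = total stage_cost pi x + d%:E * total away pi x.
Proof.
move=> d0 pol.
have aw k : 0 <= expect_state S pi x k (fun y => away y (pi k y)).
  by apply: expect_state_ge0 => // y; exact: away_ge0.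
have sc y k : 0 <= stage_cost y (pi k y) by exact: stage_cost_ge0.
rewrite /total /tail -nneseriesZl // -nneseriesD => [|k _ _|k _ _]; last 2 first.
- exact: expect_state_ge0.
- by rewrite mule_ge0.
apply: eq_eseriesr => k _; rewrite -expect_stateZ // => [|y]; last exact: away_ge0.
by rewrite -expect_stateD // => y; rewrite mule_ge0 ?away_ge0.
Qed.

Lemma Jhat_lb pi x : proper_at S x pi -> Jhat S x <= total stage_cost pi x.
Proof.
move=> /[dup] pr [pol _ _]; rewrite -policy_costE //.
by apply: ereal_inf_lbound; exists pi.
Qed.

Lemma Jhat_ge0 x : 0 <= Jhat S x.
Proof.
apply: le_ereal_inf_tmp => _ [pi [pol _ _] <-].
by rewrite policy_costE // total_ge0.
Qed.
Hint Resolve Jhat_ge0 : core.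

(** A policy of finite perturbed cost is proper, since [d > 0] bounds the expected
    time away from the destination. So the policies that the comparison
    principle provides are competitors for [Jhat]. *)
Lemma Jhat_le_supersolution (d : R) J x : (0 < d)%R -> (forall y, 0 <= J y) ->
  (forall y, bellman_op (perturbed d) J y <= J y) -> Jhat S x <= J x.
Proof.
move=> d0 J0 TJ; have d0' := ltW d0.
have [Joo|] := ltP (J x) +oo; last by rewrite leye_eq => /eqP ->; exact: leey.
apply/lee_addgt0Pr => eps eps0.
have [pi pol /(_ x)] := near_optimal_policy (perturbed_ge0 d0') eps0 J0 TJ.
rewrite total_perturbed // => piJ.
have s0 := total_ge0 stage_cost_ge0 x pol.
have a0 := total_ge0 away_ge0 x pol.
apply: (@le_trans _ _ (total stage_cost pi x)); last first.
  by apply: le_trans piJ; rewrite leeDl // mule_ge0.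
have foo : total stage_cost pi x + d%:E * total away pi x < +oo.
  by apply: le_lt_trans piJ _; rewrite lte_add_pinfty // ltry.
apply: Jhat_lb; apply/properE; split=> //.
  by apply: le_lt_trans foo; rewrite leeDl // mule_ge0.
rewrite ltey; apply/eqP => aoo; move: foo.
by rewrite aoo gt0_muley ?lte_fin // addey ?ltxx // gt_eqF // (lt_le_trans _ s0).
Qed.

(** [optimum] is replaced by its image under [bellman_op], again a supersolution
    by monotonicity, because the next step needs the infimum over the first
    control in evidence. *)
Lemma Jhat_le_perturbed (d : R) x : (0 < d)%R ->
  Jhat S x <= bellman_op (perturbed d) (optimum (perturbed d)) x.
Proof.
move=> d0; have p0 := perturbed_ge0 (ltW d0).
apply: (@Jhat_le_supersolution d (bellman_op _ _)) => // y.
  by apply: bellman_op_ge0 => // z; exact: optimum_ge0.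
by apply: le_bellman_op => z; exact: optimum_supersolution.
Qed.

(** A policy that is proper at a state stays proper at each successor reached with
    positive probability, as a finite expectation forces finite values there. *)
Lemma proper_shift pi x w : proper_at S x pi ->
  (0 < prob S x (pi 0%N x) w)%R ->
  proper_at S (dyn S x (pi 0%N x) w) (shift pi).
Proof.
move=> /properE[pol s a] pw; apply/properE; split; first exact: policy_shift.
  exact: total_shift_lty.
exact: total_shift_lty.
Qed.

Lemma bellman_le_Jhat x : bellman_op stage_cost (Jhat S) x <= Jhat S x.
Proof.
apply: le_ereal_inf_tmp => _ [pi /[dup] pr [pol _ _] <-].
rewrite policy_costE // totalS //.
apply: le_trans (bellman_op_lb _ _ (pol 0%N x)) _; rewrite leeD2l // le_mean //.
by move=> w pw; apply: Jhat_lb; exact: proper_shift.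
Qed.

Lemma Jhat_near_optimal (eps : R) x : (0 < eps)%R -> Jhat S x < +oo ->
  exists2 pi, proper_at S x pi & total stage_cost pi x <= Jhat S x + eps%:E.
Proof.
move=> eps0 Joo; have Jfin : Jhat S x \is a fin_num by rewrite ge0_fin_numE.
have [_ [pi pr <-] /ltW piJ] := lb_ereal_inf_adherent eps0 Jfin.
by exists pi => //; case: (pr) => pol _ _; rewrite -policy_costE.
Qed.

(** The perturbation vanishes in the limit: at each successor take a proper policy
    that is near-optimal for [Jhat], and let [d] be so small that [d] times its
    expected termination time is negligible. Finiteness of the disturbance set
    provides a common [d]. *)
Lemma Jhat_le_Qvalue x u : ctrl S x u ->
  Jhat S x <= stage_cost x u + mean x u (Jhat S).
Proof.
move=> ux.
have [Moo|] := ltP (mean x u (Jhat S)) +oo; last first.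
  rewrite leye_eq => /eqP ->; rewrite addey ?leey // gt_eqF //.
  by rewrite (lt_le_trans ltNy0) // stage_cost_ge0.
(* One third for the perturbed first stage, one for the near-optimality of the
   chosen policies, one for their perturbation. *)
apply/lee_addgt0Pr => eps eps0; pose e := (eps / 3)%R.
have e0 : (0 < e)%R by rewrite divr_gt0.
have /choice[f fP] w : exists pi, (0 < prob S x u w)%R ->
    proper_at S (dyn S x u w) pi /\
    total stage_cost pi (dyn S x u w) <= Jhat S (dyn S x u w) + e%:E.
  have [pw|pw] := ltP 0%R (prob S x u w); last by exists (fun _ _ => u).
  have [|pi] := @Jhat_near_optimal e (dyn S x u w) e0; last by exists pi.
  exact: (expect_lty (fun v => prob_ge0 v ux) Moo).
pose N w : R := `|fine (total away (f w) (dyn S x u w))|%R.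
have N0 : (0 <= \sum_w N w)%R by apply: sumr_ge0 => w _; exact: normr_ge0.
(* The sum bounds every [N w], and the added 1 also gives [d <= e]. *)
pose d := (e / (1 + \sum_w N w))%R.
have D0 : (0 < 1 + \sum_w N w)%R by rewrite ltr_pwDl.
have d0 : (0 < d)%R by rewrite divr_gt0.
have de : (d <= e)%R by rewrite ler_pdivrMr // ler_peMr ?(ltW e0) // lerDl.
have dN w : (d * N w <= e)%R.
  rewrite mulrAC ler_pdivrMr // ler_wpM2l ?(ltW e0) //.
  by rewrite (bigD1 w) //= addrCA lerDl addr_ge0 // sumr_ge0 // => v _;
    exact: normr_ge0.
have optE v : (0 < prob S x u v)%R ->
    optimum (perturbed d) (dyn S x u v) <= Jhat S (dyn S x u v) + (e + e)%:E.
  move=> /fP[/properE[pol soo aoo] fJ].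
  apply: le_trans (optimum_lb _ _ pol) _.
  rewrite total_perturbed ?(ltW d0) // EFinD addeA leeD //.
  have a0 := total_ge0 away_ge0 (dyn S x u v) pol.
  have afin : total away (f v) (dyn S x u v) \is a fin_num by rewrite ge0_fin_numE.
  apply: (@le_trans _ _ (d * N v)%:E); last by rewrite lee_fin.
  by rewrite /N ger0_norm ?fine_ge0 // [leRHS]EFinM fineK.
apply: le_trans (Jhat_le_perturbed x d0) _.
apply: le_trans (bellman_op_lb _ _ ux) _.
have -> : eps%:E = e%:E + (e + e)%:E.
  by rewrite -EFinD; congr EFin; rewrite /e; field.
rewrite addeACA leeD //.
  by apply: le_trans (perturbed_le _ _ (ltW d0)) _; rewrite leeD2l // lee_fin.
by rewrite -mean_addr //; exact: le_mean.
Qed.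

Lemma Jhat_bellman x : Jhat S x = bellman_op stage_cost (Jhat S) x.
Proof.
apply/le_anti; rewrite bellman_le_Jhat andbT.
by apply: le_ereal_inf_tmp => _ [u ux <-]; exact: Jhat_le_Qvalue.
Qed.

(** After [k] steps the shifted policy is still proper at the states reached, so
    its remaining cost dominates [Jhat] there. *)
Lemma expect_state_Jhat_le_tail k pi x : proper_at S x pi ->
  expect_state S pi x k (Jhat S) <= tail stage_cost k pi x.
Proof.
elim: k pi x => [|k IH] pi x /[dup] pr [pol _ _].
  by rewrite expect_state0; exact: Jhat_lb.
rewrite tailS // expect_stateS //; apply: le_mean => // w pw.
by apply: IH; exact: proper_shift.
Qed.

Lemma expect_state_dest pi k J : policy S pi -> (forall y, 0 <= J y) ->
  J (dest S) = 0 -> expect_state S pi (dest S) k J = 0.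
Proof.
move=> pol J0 Jt; elim: k pi pol => [|k IH] pi pol; first by rewrite expect_state0.
rewrite expect_stateS // /mean /expect big1 // => w _.
by rewrite dest_absorbing // IH ?mule0 //; exact: policy_shift.
Qed.

Lemma exists_policy : exists pi, policy S pi.
Proof.
have /choice[mu muP] := ctrl_nonempty S.
by exists (stationary mu) => k x; exact: muP.
Qed.

Lemma total_dest h pi : nonneg h -> policy S pi ->
  (forall u, ctrl S (dest S) u -> h (dest S) u = 0) -> total h pi (dest S) = 0.
Proof.
move=> h0 pol ht; apply: eseries0 => k _ _.
by apply: expect_state_dest => // [y|]; [exact: h0|exact: ht].
Qed.

Lemma Jhat_dest : Jhat S (dest S) = 0.
Proof.
have [pi pol] := exists_policy.
have s0 : total stage_cost pi (dest S) = 0.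
  apply: total_dest => // u ut; rewrite /stage_cost /expect big1 // => w _.
  by rewrite dest_cost_free // mule0.
have a0 : total away pi (dest S) = 0.
  by apply: total_dest => // u _; rewrite /away; case: asboolP.
apply/le_anti; rewrite Jhat_ge0 andbT -s0; apply: Jhat_lb.
by apply/properE; rewrite s0 a0.
Qed.

(** * Value iteration and optimal stationary policies *)

Lemma What_Jhat : What S (Jhat S).
Proof.
split=> [|//|pi x pr]; first by split=> //; exact: Jhat_dest.
have [pol soo _] := (properE _ _).1 pr.
apply: (@squeeze_cvge _ _ _ _ (cst 0) _ (tail stage_cost ^~ pi ^~ x)).
- apply: nearW => k; rewrite expect_state_ge0 //=.
  exact: expect_state_Jhat_le_tail.
- exact: cvg_cst.
- by apply: nneseries_tail_cvg => // k _; exact: expect_stage_ge0.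
Qed.

Section ValueIteration.
Variable J : nat -> X -> \bar R.
Hypothesis J0W : What S (J 0%N).
Hypothesis JS : forall k x, J k.+1 x = bellman S (J k) x.

Let J00 x : 0 <= J 0%N x.
Proof. by case: J0W => -[]. Qed.

Lemma iterate_ge0 k x : 0 <= J k x.
Proof.
by elim: k x => [//|k IH] x; rewrite JS bellmanE //; exact: bellman_op_ge0.
Qed.

Lemma iterate_ge_Jhat k x : Jhat S x <= J k x.
Proof.
elim: k x => [|k IH] x; first by case: J0W.
rewrite JS (bellmanE _ (iterate_ge0 k)) Jhat_bellman; exact: le_bellman_op.
Qed.

Lemma iterate_le_horizon k pi x : policy S pi ->
  J k x <= horizon stage_cost (J 0%N) k pi x.
Proof.
elim: k pi x => [|k IH] pi x pol; first by rewrite horizon0.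
rewrite JS (bellmanE _ (iterate_ge0 k)) horizonS //.
apply: le_trans (bellman_op_lb _ _ (pol 0%N x)) _.
by rewrite leeD2l // le_mean // => w _; apply: IH; exact: policy_shift.
Qed.

Lemma iterate_cvg x : J k x @[k --> \oo] --> Jhat S x.
Proof.
apply: limn_esup_le_cvg => [|k]; last exact: iterate_ge_Jhat.
apply: le_ereal_inf_tmp => _ [pi /[dup] pr [pol _ _] <-].
rewrite policy_costE //.
have hcvg : horizon stage_cost (J 0%N) k pi x @[k --> \oo] --> total stage_cost pi x.
  by apply: horizon_cvg => //; case: J0W => _ _; exact.
rewrite -(cvg_limn_einf_sup hcvg).2; apply: le_limn_esup => k.
exact: iterate_le_horizon.
Qed.

End ValueIteration.

(** Attaining the minimum makes [Jhat] a supersolution for [mu] with zero errors,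
    so [mu] costs at most [Jhat]; being proper, it also costs at least that. *)
Lemma argmin_optimal mu : policy S (stationary mu) ->
  (forall x, Xhat S x -> proper_at S x (stationary mu)) ->
  (forall x, argmin_bellman S (Jhat S) x (mu x)) -> optimal_among_proper S mu.
Proof.
move=> pol pr amu x xX; apply/le_anti/andP; split; last first.
  by rewrite policy_costE //; apply: Jhat_lb; exact: pr.
rewrite policy_costE // -[leRHS]adde0.
apply: (@total_le_supersolution _ _ _ (fun=> 0%R)) => // [k y|n].
  by have [uy] := amu y; rewrite QvalueE // bellmanE // -Jhat_bellman adde0 => ->.
by rewrite big1.
Qed.

(** Outside [Xhat] both sides are infinite. On [Xhat] the cost of [mu] is its first
    stage plus its own cost at the successors, where it is again proper and so
    costs at least [Jhat]. *)
Lemma optimal_argmin mu : policy S (stationary mu) ->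
  (forall x, Xhat S x -> proper_at S x (stationary mu)) ->
  optimal_among_proper S mu -> forall x, argmin_bellman S (Jhat S) x (mu x).
Proof.
move=> pol pr opt x; have ux := pol 0%N x; split=> //.
rewrite QvalueE // bellmanE // -Jhat_bellman; apply/le_anti.
rewrite Jhat_le_Qvalue // andbT.
have [xX|] := ltP (Jhat S x) +oo; last by rewrite leye_eq => /eqP ->; exact: leey.
rewrite -[leRHS]opt // policy_costE // totalS // leeD2l // le_mean // => w pw.
by apply: Jhat_lb; apply: (proper_shift (pr _ xX)).
Qed.

End Dynamics.

Theorem proposition6 (R : realType) (X U : Type) (W : finType)
    (S : ssp R X U W) :
  [/\ (* (a) *)
      [/\ What S (Jhat S),
          (forall x, Jhat S x = bellman S (Jhat S) x) &
          (forall J : X -> \bar R, What S J ->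
             (forall x, J x = bellman S J x) -> forall x, J x = Jhat S x)],
      (* (b) *)
      (forall J : nat -> X -> \bar R, What S (J 0%N) ->
         (forall k x, J k.+1 x = bellman S (J k) x) ->
         forall x, J k x @[k --> \oo] --> Jhat S x) &
      (* (c) *)
      (forall mu : X -> U, policy S (stationary mu) ->
         (forall x, Xhat S x -> proper_at S x (stationary mu)) ->
         ((forall x, argmin_bellman S (Jhat S) x (mu x)) ->
            optimal_among_proper S mu) /\
         (optimal_among_proper S mu ->
            forall x, argmin_bellman S (Jhat S) x (mu x)))].
Proof.
split.
- split=> [|x|J WJ JE x]; first exact: What_Jhat.
    by rewrite bellmanE ?Jhat_bellman // => y; exact: Jhat_ge0.
  have := @iterate_cvg _ _ _ _ S (fun=> J) WJ (fun=> JE) x.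
  by move/cvg_lim => <- //; rewrite lim_cst.
- by move=> J WJ JS x; exact: iterate_cvg.
- by move=> mu pol pr; split; [exact: argmin_optimal|exact: optimal_argmin].
Qed.
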